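(* Let $k$ be a field containing $\mathbb{Q}$ and let $H=\bigoplus_{n\ge 0}H_n$ be a connected, graded, commutative Hopf algebra over $k$, with antipode $S$ and grading operator $Y$. Let $D=S\ast Y$ be the graded Dynkin operator. For $\alpha\in\mathfrak{g}(H)$ put $$Q(\alpha)=\sum_{n=0}^\infty Q_n(\alpha).$$ Then $Q$ is a bijection from infinitesimal characters to characters, $Q\colon\mathfrak{g}(H)\to G(H)$, and its inverse is given by right composition with the Dynkin idempotent $Y^{-1}\circ D$: $$Q^{-1}(\beta)=\beta\circ Y^{-1}\circ D\qquad\text{for all }\beta\in G(H).$$
   Context: Graded connected Hopf algebra: $H=\bigoplus_{n\ge0}H_n$ with $H_0=k$, product, coproduct and antipode compatible with the grading, i.e. $H_pH_q\subset H_{p+q}$, $\Delta(H_n)\subset\bigoplus_{p+q=n}H_p\otimes H_q$, $S(H_n)\subset H_n$. Let $\epsilon$ be the counit and $\eta$ the unit map. Grading operator: $Y\colon H\to H$, $Y(h)=nh$ for $h\in H_n$. $Y$ is invertible on $\bigoplus_{n\geq 1}H_n$, and $Y^{-1}$ denotes the inverse there. Convolution: for linear maps $f,g$ from $H$ to an algebra $A$, $f\ast g=\mu_A\circ(f\otimes g)\circ\Delta$. The graded Dynkin operator is $D:=S\ast Y\colon H\to H$ (convolution in $\mathrm{End}_k(H)$). It preserves degree and $D(1)=0$, so $Y^{-1}\circ D$ is well defined on $H$. Characters: $G(H)$ is the set of linear maps $\beta\colon H\to k$ with $\beta(1)=1$ and $\beta(hh')=\beta(h)\beta(h')$. Infinitesimal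 characters: $\mathfrak{g}(H)$ is the set of linear maps $\alpha\colon H\to k$ with $\alpha(hh')=\alpha(h)\epsilon(h')+\epsilon(h)\alpha(h')$. The unit of convolution on $H^*=\mathrm{Hom}_k(H,k)$ is $\epsilon$. The polynomials $Q_n$: let $\mathcal{I}=\{d_j\}_{j\ge1}$ be an alphabet. For a word $\omega=d_{j_1}\cdots d_{j_l}$ let $|\omega|=j_1+\cdots+j_l$, let $\#(\omega)=l$ be its length, and let $$\kappa(\omega)=\frac{j_1j_2\cdots j_l}{j_1(j_1+j_2)\cdots(j_1+j_2+\cdots+j_l)}.$$ In the free associative (non-commutative) algebra on $\mathcal{I}$ define $Q_0=\mathbb{1}$ (the empty word) and, for $n\ge1$, $Q_n=\sum_{l=1}^n Q_{n,l}$ with $Q_{n,l}=\sum_{|\omega|=n,\ \#(\omega)=l}\kappa(\omega)\,\omega$. Evaluation at $\alpha\in H^*$: $Q_n(\alpha)$ is the image of $Q_n$ under the unital algebra homomorphism from the free algebra to $(H^*,\ast)$ sending $d_i$ to $\alpha_i$, where $\alpha_i$ is the restriction $\alpha|_{H_i}$, extended by zero to the other graded components. Thus $Q_0(\alpha)=\epsilon$ and, for $n\geq 1$, $Q_n(\alpha)=\sum_{j_1+\cdots+j_l=n,\ j_i>0}\kappa(d_{j_1}\cdots d_{j_l})\,\alpha_{j_1}\ast\cdots\ast\alpha_{j_l}$. Since $Q_n(\alpha)$ is supported on $H_n$, the infinite sum defining $Q(\alpha)$ is finite on every element of $H$. *)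

(* Defs.v *)
From HB Require Import structures.
From mathcomp Require Import all_boot all_algebra.
From mathcomp Require Import boolp classical_sets functions cardinality fsbigop.

Set Implicit Arguments.
Unset Strict Implicit.
Unset Printing Implicit Defensive.

Import GRing.Theory.
Local Open Scope quotient_scope.
Local Open Scope classical_set_scope.
Local Open Scope ring_scope.

Reserved Notation "x ⊗ y" (at level 40, left associativity).

(* Tensor product of vector spaces. Elements are formal finite sums        *)
(* [:: (u1, v1); ...; (ur, vr)], two of them being identified when no       *)
(* bilinear map separates them. tens_liftE, tens_lift_linear and           *)
(* tens_lift_unique are the universal property.                            *)
Section Tensor.
Variables (k : fieldType) (U V : lmodType k).

Definition is_bilinear (W : lmodType k) (f : U -> V -> W) : Prop :=
  (forall v, linear (f ^~ v)) /\ (forall u, linear (f u)).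

Definition tens_eval (W : nmodType) (f : U -> V -> W) (s : seq (U * V)) : W :=
  \sum_(p <- s) f p.1 p.2.

Definition tens_equiv (s t : seq (U * V)) : bool :=
  `[< forall (W : lmodType k) (f : U -> V -> W),
        is_bilinear f -> tens_eval f s = tens_eval f t >].

Lemma tens_equiv_is_equiv : equiv_class_of tens_equiv.
Proof.
split=> [s|s t|s t r].
- exact/asboolP.
- by apply/asboolP/asboolP => st W f bf; rewrite (st W f bf).
- by move=> /asboolP ts /asboolP tr; apply/asboolP => W f bf; rewrite ts ?tr.
Qed.

Canonical tens_equiv_equiv := EquivRelPack tens_equiv_is_equiv.
Canonical tens_equiv_encModRel := defaultEncModRel tens_equiv.

Definition tens := {eq_quot tens_equiv}.

HB.instance Definition _ : EqQuotient _ tens_equiv tens := EqQuotient.on tens.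
HB.instance Definition _ := Choice.on tens.

Definition tens_class (s : seq (U * V)) : tens := \pi_tens s.

Definition pure (u : U) (v : V) : tens := tens_class [:: (u, v)].

(* Meaningful for bilinear f, otherwise it depends on representatives. *)
Definition tens_lift (W : nmodType) (f : U -> V -> W) (t : tens) : W :=
  tens_eval f (repr t).

Lemma tens_lift_pi (W : lmodType k) (f : U -> V -> W) s :
  is_bilinear f -> tens_lift f (tens_class s) = tens_eval f s.
Proof.
move=> bf; have /eqmodP/asboolP/(_ W f bf) // : repr (tens_class s) = s %[mod tens].
by rewrite reprK.
Qed.

Lemma tens_eqP (s t : seq (U * V)) :
  (forall (W : lmodType k) (f : U -> V -> W),
     is_bilinear f -> tens_eval f s = tens_eval f t) ->
  tens_class s = tens_class t.
Proof. by move=> st; apply/eqmodP/asboolP. Qed.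

Lemma tens_lift_inj (s t : tens) :
  (forall (W : lmodType k) (f : U -> V -> W),
     is_bilinear f -> tens_lift f s = tens_lift f t) -> s = t.
Proof. by move=> st; rewrite -[s]reprK -[t]reprK; apply: tens_eqP. Qed.

Definition tens_zero : tens := tens_class [::].
Definition tens_add (s t : tens) : tens := tens_class (repr s ++ repr t).
Definition tens_scale (a : k) (s : tens) : tens :=
  tens_class [seq (a *: p.1, p.2) | p <- repr s].
Definition tens_opp := tens_scale (-1).

Section LiftMorph.
Variables (W : lmodType k) (f : U -> V -> W) (bf : is_bilinear f).

Lemma tens_lift0 : tens_lift f tens_zero = 0.
Proof. by rewrite tens_lift_pi // /tens_eval big_nil. Qed.

Lemma tens_liftD s t : tens_lift f (tens_add s t) = tens_lift f s + tens_lift f t.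
Proof. by rewrite tens_lift_pi // /tens_eval big_cat. Qed.

Lemma tens_liftZ a s : tens_lift f (tens_scale a s) = a *: tens_lift f s.
Proof.
rewrite tens_lift_pi // /tens_lift /tens_eval big_map scaler_sumr.
by apply: eq_bigr => p _ /=; apply: (scalable_linear (bf.1 p.2)).
Qed.
End LiftMorph.

Lemma tens_addA : associative tens_add.
Proof. by move=> s t r; apply: tens_lift_inj => W f bf; rewrite !tens_liftD // addrA. Qed.
Lemma tens_addC : commutative tens_add.
Proof. by move=> s t; apply: tens_lift_inj => W f bf; rewrite !tens_liftD // addrC. Qed.
Lemma tens_add0 : left_id tens_zero tens_add.
Proof.
by move=> s; apply: tens_lift_inj => W f bf; rewrite tens_liftD // tens_lift0 // add0r.
Qed.
Lemma tens_addN : left_inverse tens_zero tens_opp tens_add.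
Proof.
move=> s; apply: tens_lift_inj => W f bf.
by rewrite tens_liftD // tens_lift0 // tens_liftZ // scaleN1r addNr.
Qed.

HB.instance Definition _ :=
  GRing.isZmodule.Build tens tens_addA tens_addC tens_add0 tens_addN.

Lemma tens_scaleA a b s : tens_scale a (tens_scale b s) = tens_scale (a * b) s.
Proof. by apply: tens_lift_inj => W f bf; rewrite !tens_liftZ // scalerA. Qed.
Lemma tens_scale1 : left_id 1 tens_scale.
Proof. by move=> s; apply: tens_lift_inj => W f bf; rewrite tens_liftZ // scale1r. Qed.
Lemma tens_scaleDr : right_distributive tens_scale +%R.
Proof.
move=> a s t; apply: tens_lift_inj => W f bf.
by rewrite tens_liftZ // !tens_liftD // !tens_liftZ // scalerDr.
Qed.
Lemma tens_scaleDl s : {morph tens_scale^~ s : a b / a + b}.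
Proof.
move=> a b; apply: tens_lift_inj => W f bf.
by rewrite tens_liftZ // tens_liftD // !tens_liftZ // scalerDl.
Qed.

HB.instance Definition _ := GRing.Zmodule_isLmodule.Build k tens
  tens_scaleA tens_scale1 tens_scaleDr tens_scaleDl.

Lemma tens_lift_linear (W : lmodType k) (f : U -> V -> W) :
  is_bilinear f -> linear (tens_lift f).
Proof. by move=> bf a s t; rewrite tens_liftD // tens_liftZ. Qed.

Lemma tens_liftE (W : lmodType k) (f : U -> V -> W) u v :
  is_bilinear f -> tens_lift f (pure u v) = f u v.
Proof. by move=> bf; rewrite tens_lift_pi // /tens_eval big_seq1. Qed.

Lemma pure_bilinear : is_bilinear pure.
Proof.
split=> [v a u u'|u a v v']; apply: tens_lift_inj => W f bf.
- by rewrite tens_liftD // tens_liftZ // !tens_liftE // bf.1.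
- by rewrite tens_liftD // tens_liftZ // !tens_liftE // bf.2.
Qed.

Lemma tens_sum (t : tens) : t = \sum_(p <- repr t) pure p.1 p.2.
Proof.
have lift_sum (W : lmodType k) (f : U -> V -> W) s : is_bilinear f ->
    tens_lift f (\sum_(p <- s) pure p.1 p.2) = tens_eval f s.
  move=> bf; rewrite /tens_eval; elim: s => [|p s IHs].
    by rewrite !big_nil tens_lift0.
  by rewrite !big_cons -IHs tens_liftD // tens_liftE.
by apply: tens_lift_inj => W f bf; rewrite lift_sum.
Qed.

Lemma tens_lift_unique (W : lmodType k) (f : U -> V -> W) (g : {linear tens -> W}) :
  is_bilinear f -> (forall u v, g (pure u v) = f u v) -> g =1 tens_lift f.
Proof.
move=> bf gE t; rewrite {1}[t]tens_sum linear_sum.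
by apply: eq_bigr => p _; rewrite gE.
Qed.

Lemma tens_eq_linear (W : lmodType k) (g h : tens -> W) : linear g -> linear h ->
  (forall u v, g (pure u v) = h (pure u v)) -> g =1 h.
Proof.
move=> lg lh gh t.
pose G := HB.pack_for {linear tens -> W} g (GRing.isLinear.Build k tens W _ g lg).
pose K := HB.pack_for {linear tens -> W} h (GRing.isLinear.Build k tens W _ h lh).
rewrite -[g]/(G : _ -> _) -[h]/(K : _ -> _) [t]tens_sum !linear_sum.
by apply: eq_bigr => p _; apply: gh.
Qed.

(* The span of the pure tensors u ⊗ v, u in A and v in B: for subspaces A *)
(* and B, the image of A ⊗ B in U ⊗ V. *)
Definition tens_sub (A : set U) (B : set V) : set tens :=
  [set t | exists2 s : seq (U * V),
     (forall p, p \in s -> A p.1 /\ B p.2) & t = \sum_(p <- s) pure p.1 p.2].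

End Tensor.

Notation "x ⊗ y" := (pure x y) : ring_scope.

Section TensorMaps.
Variable k : fieldType.

Definition tens_map (U V U' V' : lmodType k) (f : U -> U') (g : V -> V') :
    tens U V -> tens U' V' :=
  tens_lift (fun u v => f u ⊗ g v).

Definition tens_assoc (U V W : lmodType k) :
    tens (tens U V) W -> tens U (tens V W) :=
  tens_lift (fun t w => tens_lift (fun u v => u ⊗ (v ⊗ w)) t).

End TensorMaps.

(* The algebra structure (a ⊗ b) (a' ⊗ b') = (a a') ⊗ (b b') on A ⊗ B. *)
Section TensorAlgebra.
Variables (k : fieldType) (A B : algType k).

Definition tens_one : tens A B := 1 ⊗ 1.
Definition tens_mul (s t : tens A B) : tens A B :=
  tens_lift (fun a b => tens_lift (fun a' b' => (a * a') ⊗ (b * b')) t) s.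

Let in_bil a b : is_bilinear (fun (a' : A) (b' : B) => (a * a') ⊗ (b * b')).
Proof.
split=> [v c u u'|u c v v'].
- by rewrite mulrDr -scalerAr (pure_bilinear _ _).1.
- by rewrite mulrDr -scalerAr (pure_bilinear _ _).2.
Qed.

Lemma tens_lift_linear_fun (U V W : lmodType k) (f g : U -> V -> W) (c : k) t :
  tens_lift (fun u v => c *: f u v + g u v) t =
  c *: tens_lift f t + tens_lift g t.
Proof.
by rewrite /tens_lift /tens_eval big_split /= scaler_sumr.
Qed.

Let out_bil t : is_bilinear (fun (a : A) (b : B) =>
  tens_lift (fun a' b' => (a * a') ⊗ (b * b')) t).
Proof.
split=> [v c u u'|u c v v']; rewrite -tens_lift_linear_fun;
  apply: eq_bigr => p _.
- by rewrite mulrDl -scalerAl (pure_bilinear _ _).1.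
- by rewrite mulrDl -scalerAl (pure_bilinear _ _).2.
Qed.

Lemma tens_mulE a b a' b' :
  tens_mul (a ⊗ b) (a' ⊗ b') = (a * a') ⊗ (b * b').
Proof. by rewrite /tens_mul tens_liftE // tens_liftE. Qed.

Lemma tens_mul_linl t : linear (tens_mul^~ t).
Proof. exact: tens_lift_linear. Qed.

Lemma tens_mul_linr s : linear (tens_mul s).
Proof.
move=> c t t'; rewrite /tens_mul -tens_lift_linear_fun.
by apply: eq_bigr => p _; apply: tens_lift_linear.
Qed.

Lemma tens_mul1 : left_id tens_one tens_mul.
Proof.
apply: tens_eq_linear => //; first exact: tens_mul_linr.
by move=> u v; rewrite tens_mulE !mul1r.
Qed.

Lemma tens_mulr1 : right_id tens_one tens_mul.
Proof.
apply: tens_eq_linear => //; first exact: tens_mul_linl.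
by move=> u v; rewrite tens_mulE !mulr1.
Qed.

Lemma tens_mulA : associative tens_mul.
Proof.
move=> s t r; move: s; apply: tens_eq_linear.
- exact: tens_mul_linl.
- by move=> c s s'; rewrite !tens_mul_linl.
move=> a b; move: t; apply: tens_eq_linear.
- by move=> c s s'; rewrite tens_mul_linl tens_mul_linr.
- by move=> c s s'; rewrite tens_mul_linr tens_mul_linl.
move=> a' b'; move: r; apply: tens_eq_linear.
- by move=> c s s'; rewrite !tens_mul_linr.
- exact: tens_mul_linr.
by move=> a'' b''; rewrite !tens_mulE !mulrA.
Qed.

Lemma tens_mulDl : left_distributive tens_mul +%R.
Proof. by move=> s t r; have := tens_mul_linl r 1 s t; rewrite !scale1r. Qed.

Lemma tens_mulDr : right_distributive tens_mul +%R.
Proof. by move=> r s t; have := tens_mul_linr r 1 s t; rewrite !scale1r. Qed.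

HB.instance Definition _ := GRing.Zmodule_isPzRing.Build (tens A B)
  tens_mulA tens_mul1 tens_mulr1 tens_mulDl tens_mulDr.

End TensorAlgebra.

Section Convolution.
Variables (k : fieldType) (H A : algType k).

Definition tens_mu : tens A A -> A := tens_lift (fun x y => x * y).

Definition convolution (Delta : H -> tens H H) (f g : H -> A) : H -> A :=
  tens_mu \o tens_map f g \o Delta.

End Convolution.

Record hopf_algebra (k : fieldType) (H : algType k) := HopfAlgebra {
  coprod : {lrmorphism H -> tens H H};
  counit : {lrmorphism H -> k^o};
  antipode : {linear H -> H};
  coprodA : forall h, tens_assoc (tens_map coprod idfun (coprod h)) =
                      tens_map idfun coprod (coprod h);
  counitl : forall h, tens_lift (fun x y => counit x *: y) (coprod h) = h;
  counitr : forall h, tens_lift (fun x y => counit y *: x) (coprod h) = h;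
  antipodel : forall h, convolution coprod antipode idfun h = (counit h)%:A;
  antipoder : forall h, convolution coprod idfun antipode h = (counit h)%:A
}.

(* Internal direct sum decomposition V = ⊕_n V_n. *)
Record grading (k : fieldType) (V : lmodType k) := Grading {
  gcomp :> nat -> set V;
  gcomp0 : forall n, gcomp n 0;
  gcompP : forall n (a : k) x y, gcomp n x -> gcomp n y -> gcomp n (a *: x + y);
  gcomp_span : forall x, exists N, exists2 f : nat -> V,
    forall n, gcomp n (f n) & x = \sum_(n < N) f n;
  gcomp_indep : forall N (f : nat -> V), (forall n, gcomp n (f n)) ->
    \sum_(n < N) f n = 0 -> forall n, (n < N)%N -> f n = 0
}.

Section Grading.
Variables (k : fieldType) (V : lmodType k) (gr : grading V).

Lemma gproj_spec x : exists p : nat * (nat -> V),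
  [/\ forall n, gr n (p.2 n), forall n, (p.1 <= n)%N -> p.2 n = 0
    & x = \sum_(n < p.1) p.2 n].
Proof.
have [N [f fP ->]] := gcomp_span gr x.
exists (N, fun n => if (n < N)%N then f n else 0); split=> /= [n|n|].
- by case: ifP => // _; apply: gcomp0.
- by rewrite ltnNge => ->.
- by apply: eq_bigr => i _; rewrite ltn_ord.
Qed.

Definition gproj (n : nat) (x : V) : V := (sval (cid (gproj_spec x))).2 n.

Lemma gproj_in n x : gr n (gproj n x).
Proof. by rewrite /gproj; case: cid => /= p []. Qed.

Lemma gproj_bound x : exists N, forall n, (N <= n)%N -> gproj n x = 0.
Proof. by rewrite /gproj; case: cid => /= p [_ p0 _]; exists p.1. Qed.

Lemma gproj_sum x N : (forall n, (N <= n)%N -> gproj n x = 0) ->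
  x = \sum_(n < N) gproj n x.
Proof.
rewrite /gproj; case: cid => /= -[M f] /= [_ f0 {1}->] fN.
have widen a b : (a <= b)%N -> (forall n, (a <= n)%N -> f n = 0) ->
    \sum_(n < b) f n = \sum_(n < a) f n.
  move=> ab fa; rewrite -(subnKC ab) big_split_ord /= [X in _ + X]big1 ?addr0 //.
  by move=> i _; apply: fa; apply: leq_addr.
by case: (leqP M N) => [/widen|/ltnW/widen] ->.
Qed.

Lemma gproj_unique x N (f : nat -> V) : (forall n, gr n (f n)) ->
  (forall n, (N <= n)%N -> f n = 0) -> x = \sum_(n < N) f n ->
  forall n, gproj n x = f n.
Proof.
move=> fP f0 xE n; have [M pM] := gproj_bound x.
pose g i := - 1 *: f i + gproj i x.
have gP i : gr i (g i) by apply: gcompP => //; apply: gproj_in.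
have g0 : \sum_(i < N + M) g i = 0.
  rewrite big_split /= -scaler_sumr scaleN1r -gproj_sum; last first.
    by move=> i /(leq_trans (leq_addl N M))/pM.
  suff -> : \sum_(i < N + M) f i = x by rewrite addNr.
  rewrite big_split_ord /= [X in _ + X]big1 ?addr0 // => i _.
  by rewrite f0 // leq_addr.
have /eqP : g n = 0.
  have [nNM|] := ltnP n (N + M); first exact: gcomp_indep g0 _ nNM.
  move=> NMn; rewrite /g f0 ?pM ?scaler0 ?addr0 //.
  - exact: leq_trans (leq_addl _ _) NMn.
  - exact: leq_trans (leq_addr _ _) NMn.
by rewrite /g scaleN1r addrC subr_eq0 => /eqP.
Qed.

Lemma gproj_id m n x : gr n x -> gproj m x = if m == n then x else 0.
Proof.
move=> xn; move: m; apply: (@gproj_unique _ n.+1) => [m|m|].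
- by case: eqP => [->|_] //; apply: gcomp0.
- by case: eqP => // ->; rewrite ltnn.
- rewrite big_ord_recr /= eqxx big1 ?add0r // => i _.
  by rewrite ltn_eqF ?ltn_ord.
Qed.

Lemma gproj_linear n : linear (gproj n).
Proof.
move=> a x y; have [N pN] := gproj_bound x; have [M pM] := gproj_bound y.
move: n; apply: (@gproj_unique _ (N + M)) => [n|n NMn|].
- by apply: gcompP; apply: gproj_in.
- rewrite pN ?pM ?scaler0 ?addr0 //.
  + exact: leq_trans (leq_addl _ _) NMn.
  + exact: leq_trans (leq_addr _ _) NMn.
- rewrite big_split /= -scaler_sumr -!gproj_sum // => n NMn.
  + by apply: pM; apply: leq_trans (leq_addl _ _) NMn.
  + by apply: pN; apply: leq_trans (leq_addr _ _) NMn.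
Qed.

HB.instance Definition _ n := GRing.isLinear.Build k V V _ (gproj n) (gproj_linear n).

Lemma gproj_fsum (D : set nat) (c : nat -> k) x N :
  (forall n, (N <= n)%N -> gproj n x = 0) ->
  \sum_(n \in D) c n *: gproj n x = \sum_(n < N | (n : nat) \in D) c n *: gproj n x.
Proof.
move=> pN; rewrite -{1}[D]set_mem_set -(@bigfs _ _ _ _ (index_iota 0 N)).
- by rewrite big_mkord.
- exact: iota_uniq.
- move=> n _; rewrite mem_index_iota /= -leqNgt => /pN ->.
  by rewrite scaler0.
Qed.

(* The sums below are finite: a vector has finitely many nonzero components. *)
Definition Ygr (x : V) : V := \sum_(n \in [set: nat]) n%:R *: gproj n x.

(* The inverse of Y on ⊕_(n >= 1) V_n, extended by zero on V_0. The extension *)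
(* is immaterial in Yinv \o dynkin, the Dynkin operator taking values in      *)
(* ⊕_(n >= 1) V_n. *)
Definition Yinv (x : V) : V :=
  \sum_(n \in [set n | (0 < n)%N]) n%:R^-1 *: gproj n x.

Lemma YgrE n x : gr n x -> Ygr x = n%:R *: x.
Proof.
move=> xn; rewrite /Ygr (@gproj_fsum _ _ _ n.+1) => [|m nm]; last first.
  by rewrite (gproj_id _ xn) gtn_eqF.
rewrite big_mkcond big_ord_recr /= in_setT (gproj_id _ xn) eqxx big1 ?add0r //.
by move=> i _; rewrite (gproj_id _ xn) ltn_eqF ?ltn_ord // scaler0 if_same.
Qed.

Lemma Ygr_linear : linear Ygr.
Proof.
move=> a x y; have [N pN] := gproj_bound x; have [M pM] := gproj_bound y.
have xN n : (N + M <= n)%N -> gproj n x = 0.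
  by move=> /(leq_trans (leq_addr _ _))/pN.
have yN n : (N + M <= n)%N -> gproj n y = 0.
  by move=> /(leq_trans (leq_addl _ _))/pM.
have xyN n : (N + M <= n)%N -> gproj n (a *: x + y) = 0.
  by move=> nNM; rewrite gproj_linear xN ?yN ?scaler0 ?addr0.
rewrite /Ygr !(gproj_fsum _ _ xN, gproj_fsum _ _ yN, gproj_fsum _ _ xyN).
rewrite scaler_sumr -big_split; apply: eq_bigr => i _ /=.
by rewrite gproj_linear scalerDr !scalerA mulrC.
Qed.

Lemma YinvK x : [pchar k] =i pred0 -> gproj 0 x = 0 -> Ygr (Yinv x) = x.
Proof.
move=> char0 x0; have [N pN] := gproj_bound x.
pose y n : V := if n == 0%N then 0 else n%:R^-1 *: gproj n x.
have yP n : gr n (y n).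
  rewrite /y; case: eqP => _; first exact: gcomp0.
  by rewrite -[_ *: _]addr0; apply: gcompP; [apply: gproj_in|apply: gcomp0].
have yN n : (N <= n)%N -> y n = 0.
  by move=> /pN nN; rewrite /y nN scaler0 if_same.
have pY n : gproj n (Yinv x) = y n.
  move: n; apply: (gproj_unique yP yN); rewrite /Yinv (gproj_fsum _ _ pN).
  rewrite big_mkcond; apply: eq_bigr => i _; rewrite /y.
  have -> : ((i : nat) \in [set n | (0 < n)%N]) = ((i : nat) != 0%N).
    by apply/idP/idP; rewrite in_setE /= lt0n.
  by case: eqP.
rewrite /Ygr (@gproj_fsum _ _ _ N) => [|n /yN]; last by rewrite pY.
rewrite [RHS](gproj_sum pN); apply: eq_big => [i|i _]; first by rewrite in_setT.
rewrite pY /y; case: eqP => [->|/eqP i0]; first by rewrite x0 scaler0.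
by rewrite scalerA divff ?scale1r // ((pcharf0P k).1 char0).
Qed.

End Grading.

Record graded_connected (k : fieldType) (H : algType k) (hopf : hopf_algebra H)
    (gr : grading H) : Prop := GradedConnected {
  connected0 : gr 0%N = range (fun a : k => a%:A : H);
  graded_mul : forall p q x y, gr p x -> gr q y -> gr (p + q)%N (x * y);
  graded_coprod : forall n x, gr n x ->
    exists2 t : nat -> tens H H,
      forall p, (p <= n)%N -> tens_sub (gr p) (gr (n - p)%N) (t p)
      & coprod hopf x = \sum_(p < n.+1) t p;
  graded_antipode : forall n x, gr n x -> gr n (antipode hopf x)
}.

Section Characters.
Variables (k : fieldType) (H : algType k) (hopf : hopf_algebra H).
Implicit Types alpha beta : H -> k^o.

Definition characters : set (H -> k^o) :=
  [set beta | [/\ linear beta, beta 1 = 1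
                & forall x y, beta (x * y) = beta x * beta y]].

Definition inf_characters : set (H -> k^o) :=
  [set alpha | linear alpha /\
     forall x y, alpha (x * y) =
       alpha x * counit hopf y + counit hopf x * alpha y].

End Characters.

Arguments characters {k} H.

Section Dynkin.
Variables (k : fieldType) (H : algType k) (hopf : hopf_algebra H).
Variable gr : grading H.

Definition dynkin : H -> H :=
  convolution (coprod hopf) (antipode hopf) (Ygr gr).

(* A word d_(j_1) ... d_(j_l) is encoded as the sequence [:: j_1; ...; j_l]. *)
Definition kappa (w : seq nat) : k :=
  (\prod_(j <- w) j)%N%:R / (\prod_(1 <= i < (size w).+1) sumn (take i w))%N%:R.

Definition gres (alpha : H -> k^o) (i : nat) : H -> k^o := alpha \o gproj gr i.

(* alpha_(j_1) * ... * alpha_(j_l), with value the counit on the empty word. *)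
Definition word_eval (alpha : H -> k^o) (w : seq nat) : H -> k^o :=
  foldr (fun j f => convolution (coprod hopf) (gres alpha j) f)
    (counit hopf : H -> k^o) w.

Definition Qnl (alpha : H -> k^o) (n l : nat) (h : H) : k^o :=
  \sum_(w : l.-tuple 'I_n.+1 |
      all (fun j : 'I_n.+1 => (0 < j)%N) w && (sumn (map val w) == n))
    kappa (map val w) *: word_eval alpha (map val w) h.

Definition Qn (alpha : H -> k^o) (n : nat) (h : H) : k^o :=
  if n == 0%N then counit hopf h else \sum_(1 <= l < n.+1) Qnl alpha n l h.

(* For linear alpha, Qn alpha n vanishes off H_n, so the sum is finite. *)
Definition Qmap (alpha : H -> k^o) (h : H) : k^o :=
  \sum_(n \in [set: nat]) Qn alpha n h.

End Dynkin.

(* Main.v *)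
From HB Require Import structures.
Require Import Defs.
From mathcomp Require Import all_boot all_algebra.
From mathcomp Require Import boolp classical_sets functions fsbigop.

(** Write [q = Q(alpha)] and [⋆] for convolution.  The coefficients [kappa]
are made so that removing the last letter [j] of a word of weight [n]
multiplies [kappa] by [n / j].  Hence [n Q_n = sum_j Q_(n-j) ⋆ (j alpha_j)],
which says that [q] solves the differential equation

      q o Y = q ⋆ (alpha o Y),       q(1) = 1                            (E)

([Qmap_equation]).  This equation governs both directions.

Since [Y] is a derivation and [alpha o Y] is again an infinitesimal
character, the defect [E(x, y) = q(xy) - q(x) q(y)] of a solution satisfies
[E(Yx, y) + E(x, Yy) = (E(-, y) ⋆ alpha Y)(x) + (E(x, -) ⋆ alpha Y)(y)].  As
[alpha o Y] kills [H_0], the right-hand side only involves the values of [E] in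
lower total degree; induction on the degree gives [E = 0], so that [q] is a
character ([Y_equation_character]).  The same induction on the degree shows
that (E) has a unique solution for a given right factor
([Y_equation_unique]).

For a character [beta], [beta o S] is the convolution inverse of [beta] and
[beta o D = (beta o S) ⋆ (beta o Y)]; in other words [beta o D] is the unique
[gamma] with [beta o Y = beta ⋆ gamma] ([dynkin_log_derivative]).  It is an
infinitesimal character, because [beta o Y] is a [beta]-derivation and
[beta] can be cancelled ([log_derivative_inf]).

Finally [D] preserves the degree, so it commutes with [Y^-1], and
[beta o Y^-1 o D = (beta o D) o Y^-1].  If [beta = Q(alpha)] then (E) gives
[beta o D = alpha o Y], whence [beta o Y^-1 o D = alpha].  If [beta] is any
character and [alpha = beta o Y^-1 o D], then [alpha o Y = beta o D], so
[beta] and [Q(alpha)] both solve (E) and are equal.  *)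

Set Implicit Arguments.
Unset Strict Implicit.
Unset Printing Implicit Defensive.

Import GRing.Theory.
Local Open Scope classical_set_scope.
Local Open Scope ring_scope.

(** * Linear and bilinear maps on tensor products *)

Section Linear.
Variable k : fieldType.

(** Turns the predicate [linear f] into a bundled linear map, to give access
to the lemmas on such maps. *)
Lemma linear_packed (U V : lmodType k) (f : U -> V) :
  linear f -> exists g : {linear U -> V}, f = g.
Proof.
move=> lf.
by exists (HB.pack_for {linear U -> V} f (GRing.isLinear.Build k U V _ f lf)).
Qed.

Lemma linear_scaled (U V : lmodType k) (f : U -> V) a x :
  linear f -> f (a *: x) = a *: f x.
Proof. by move=> /linear_packed[g ->]; rewrite linearZ. Qed.

Lemma linear_comp (U V W : lmodType k) (f : V -> W) (g : U -> V) :
  linear f -> linear g -> linear (f \o g).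
Proof. by move=> lf lg a x y /=; rewrite lg lf. Qed.

Lemma linear_add (U V : lmodType k) (f g : U -> V) :
  linear f -> linear g -> linear (fun x => f x + g x).
Proof. by move=> lf lg a x y; rewrite lf lg scalerDr addrACA. Qed.

Lemma linear_scale (U V : lmodType k) (a : k) (f : U -> V) :
  linear f -> linear (fun x => a *: f x).
Proof. by move=> lf b x y; rewrite lf scalerDr !scalerA mulrC. Qed.

Lemma linear_sub (U V : lmodType k) (f g : U -> V) :
  linear f -> linear g -> linear (fun x => f x - g x).
Proof. by move=> lf lg a x y; rewrite lf lg scalerBr opprD addrACA. Qed.

Lemma linear_sum_fun (I : Type) (r : seq I) (U V : lmodType k) (f : I -> U -> V) :
  (forall i, linear (f i)) -> linear (fun x => \sum_(i <- r) f i x).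
Proof.
move=> lf a x y; rewrite scaler_sumr -big_split.
by apply: eq_bigr => i _; apply: lf.
Qed.

Lemma linear_mull (A : algType k) (a : A) : linear (fun x : A => a * x).
Proof. by move=> c x y; rewrite mulrDr scalerAr. Qed.

Lemma linear_mulr (A : algType k) (a : A) : linear (fun x : A => x * a).
Proof. by move=> c x y; rewrite mulrDl scalerAl. Qed.

Lemma bilinear_mul (U V : lmodType k) (A : algType k) (f : U -> A) (g : V -> A) :
  linear f -> linear g -> is_bilinear (fun u v => f u * g v).
Proof.
move=> lf lg; split=> [v|u].
  exact: (linear_comp (linear_mulr _) lf).
exact: (linear_comp (linear_mull _) lg).
Qed.

Lemma tens_lift_map (U V U' V' W : lmodType k) (f : U -> U') (g : V -> V')
    (b : U' -> V' -> W) t : is_bilinear b ->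
  tens_lift b (tens_map f g t) = tens_lift (fun u v => b (f u) (g v)) t.
Proof.
move=> bb; have [L LE] := linear_packed (tens_lift_linear bb).
rewrite LE /tens_map [in LHS]/tens_lift /tens_eval linear_sum.
by apply: eq_bigr => p _; rewrite -LE tens_liftE.
Qed.

(** Summing a trilinear map over an iterated coproduct does not depend on the
bracketing; this turns coassociativity into an equality of Sweedler sums. *)
Lemma tens_lift_assoc (U V W X : lmodType k) (b : U -> V -> W -> X) s :
  (forall u v, linear (b u v)) -> (forall u w, linear (fun v => b u v w)) ->
  (forall v w, linear (fun u => b u v w)) ->
  tens_lift (fun u t => tens_lift (b u) t) (tens_assoc s) =
  tens_lift (fun t w => tens_lift (fun u v => b u v w) t) s.
Proof.
move=> b3 b2 b1.
have bu u : is_bilinear (b u) by split=> [w|v]; [apply: b2|apply: b3].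
have bw w : is_bilinear (fun u v => b u v w) by split=> [v|u]; [apply: b1|apply: b2].
have bL : is_bilinear (fun u t => tens_lift (b u) t).
  split=> [t c u u'|u]; last exact: tens_lift_linear.
  by rewrite -tens_lift_linear_fun; apply: eq_bigr => p _; apply: b1.
have bR : is_bilinear (fun t w => tens_lift (fun u v => b u v w) t).
  split=> [w|t c w w']; first exact: tens_lift_linear.
  by rewrite -tens_lift_linear_fun; apply: eq_bigr => p _; apply: b3.
have bp (w : W) : is_bilinear (fun (u : U) (v : V) => u ⊗ (v ⊗ w)).
  split=> [v c u u'|u c v v']; first by rewrite (pure_bilinear _ _).1.
  by rewrite (pure_bilinear _ _).1 (pure_bilinear _ _).2.
have ba : is_bilinear (fun (t : tens U V) (w : W) =>
    tens_lift (fun u v => u ⊗ (v ⊗ w)) t).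
  split=> [w|t c w w']; first exact: tens_lift_linear.
  rewrite -tens_lift_linear_fun; apply: eq_bigr => p _.
  by rewrite !(pure_bilinear _ _).2.
have lL := tens_lift_linear bL.
move: s; apply: tens_eq_linear.
- exact: (linear_comp lL (tens_lift_linear ba)).
- exact: tens_lift_linear.
move=> t w; rewrite /tens_assoc !tens_liftE //; move: t; apply: tens_eq_linear.
- exact: (linear_comp lL (tens_lift_linear (bp w))).
- exact: tens_lift_linear.
by move=> u v; rewrite !tens_liftE.
Qed.

End Linear.

(** * The convolution algebra *)

Section Convolution.
Variables (k : fieldType) (H : algType k) (hopf : hopf_algebra H).
Local Notation Delta := (coprod hopf).
Local Notation eps := (counit hopf : H -> k^o).
Local Notation "f ⋆ g" := (convolution Delta f g) (at level 40, left associativity).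
Implicit Types f g h : H -> k^o.

Lemma convolutionE (A : algType k) (f g : H -> A) x :
  (f ⋆ g) x = tens_lift (fun u v => f u * g v) (Delta x).
Proof. by rewrite /convolution /= /tens_mu tens_lift_map //; apply: bilinear_mul. Qed.

Lemma convolution_linear (A : algType k) (f g : H -> A) :
  linear f -> linear g -> linear (f ⋆ g).
Proof.
move=> lf lg a x y; rewrite !convolutionE linearP.
exact: (tens_lift_linear (bilinear_mul lf lg)).
Qed.

Lemma convolutionA (A : algType k) (f g h : H -> A) :
  linear f -> linear g -> linear h -> (f ⋆ g) ⋆ h =1 f ⋆ (g ⋆ h).
Proof.
move=> lf lg lh x; pose b u v w := f u * (g v * h w).
have b1 v w : linear (fun u => b u v w) by exact: (linear_comp (linear_mulr _) lf).
have b2 u w : linear (fun v => b u v w).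
  exact: (linear_comp (linear_mull _) (linear_comp (linear_mulr _) lg)).
have b3 u v : linear (fun w => b u v w).
  exact: (linear_comp (linear_mull _) (linear_comp (linear_mull _) lh)).
have := congr1 (tens_lift (fun u t => tens_lift (b u) t)) (coprodA hopf x).
rewrite tens_lift_assoc // !tens_lift_map; first last.
- split=> [w|t c w w']; first by apply: tens_lift_linear; split.
  by rewrite -tens_lift_linear_fun; apply: eq_bigr => p _; apply: b3.
- split=> [t c u u'|u]; last by apply: tens_lift_linear; split.
  by rewrite -tens_lift_linear_fun; apply: eq_bigr => p _; apply: b1.
rewrite !convolutionE => E; transitivity (tens_lift (fun u v =>
    tens_lift (fun u0 v0 => b u0 v0 (idfun v)) (Delta u)) (Delta x)).
  apply: eq_bigr => p _; rewrite convolutionE /tens_lift /tens_eval mulr_suml.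
  by apply: eq_bigr => q _; rewrite -mulrA.
rewrite E; apply: eq_bigr => p _; rewrite convolutionE /tens_lift /tens_eval mulr_sumr.
by [].
Qed.

Lemma counit_linear : linear eps.
Proof. exact: linearP. Qed.

Lemma convolution_counitl f : linear f -> eps ⋆ f =1 f.
Proof.
move=> lf x; have [F FE] := linear_packed lf.
rewrite convolutionE FE -[in RHS](counitl hopf x) /tens_lift /tens_eval linear_sum.
by apply: eq_bigr => p _; rewrite linearZ.
Qed.

Lemma convolution_counitr f : linear f -> f ⋆ eps =1 f.
Proof.
move=> lf x; have [F FE] := linear_packed lf.
rewrite convolutionE FE -[in RHS](counitr hopf x) /tens_lift /tens_eval linear_sum.
by apply: eq_bigr => p _; rewrite linearZ /= mulrC.
Qed.

(** The coproduct is multiplicative, so a convolution product evaluated at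
[x * y] is a double Sweedler sum over the coproducts of [x] and [y]. *)
Lemma convolution_mul f g x y : linear f -> linear g ->
  (f ⋆ g) (x * y) = tens_lift (fun u v =>
     tens_lift (fun u' v' => f (u * u') * g (v * v')) (Delta y)) (Delta x).
Proof.
move=> lf lg; rewrite convolutionE rmorphM.
have bb := bilinear_mul lf lg; have [L LE] := linear_packed (tens_lift_linear bb).
rewrite LE -[_ * _]/(tens_mul _ _) /tens_mul [in LHS]/tens_lift [in LHS]/tens_eval.
rewrite linear_sum; apply: eq_bigr => p _; rewrite linear_sum.
by apply: eq_bigr => q _; rewrite -LE tens_liftE.
Qed.

End Convolution.

(** * Graded vector spaces *)

Section GradedSpace.
Variables (k : fieldType) (V : lmodType k) (gr : grading V).

Lemma gcompZ n a x : gr n x -> gr n (a *: x).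
Proof. by move=> xn; rewrite -[_ *: _]addr0; apply: gcompP => //; apply: gcomp0. Qed.

Lemma gcompD n x y : gr n x -> gr n y -> gr n (x + y).
Proof. by move=> xn yn; rewrite -[x]scale1r; apply: gcompP. Qed.

Lemma gcomp_disjoint m n x : gr m x -> gr n x -> m != n -> x = 0.
Proof.
move=> xm xn mn; have := gproj_id m xm; rewrite (gproj_id m xn) eqxx.
by rewrite (negPf mn).
Qed.

Lemma graded_ext (W : lmodType k) (f g : V -> W) : linear f -> linear g ->
  (forall n x, gr n x -> f x = g x) -> f =1 g.
Proof.
move=> lf lg fg x; have [N pN] := gproj_bound gr x.
have [F FE] := linear_packed lf; have [G GE] := linear_packed lg.
rewrite (gproj_sum pN) FE GE !linear_sum -FE -GE; apply: eq_bigr => i _.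
exact: fg (gproj_in _ _ _).
Qed.

Lemma Yinv_linear : linear (Yinv gr).
Proof.
move=> a x y; have [N pN] := gproj_bound gr x; have [M pM] := gproj_bound gr y.
have xN n : (N + M <= n)%N -> gproj gr n x = 0.
  by move=> /(leq_trans (leq_addr _ _))/pN.
have yN n : (N + M <= n)%N -> gproj gr n y = 0.
  by move=> /(leq_trans (leq_addl _ _))/pM.
have xyN n : (N + M <= n)%N -> gproj gr n (a *: x + y) = 0.
  by move=> nNM; rewrite linearP /= xN ?yN ?scaler0 ?addr0.
rewrite /Yinv !(gproj_fsum _ _ xN, gproj_fsum _ _ yN, gproj_fsum _ _ xyN).
rewrite scaler_sumr -big_split; apply: eq_bigr => i _ /=.
by rewrite linearP scalerDr !scalerA mulrC.
Qed.

(** The degree 0 case is covered by the convention that [0^-1 = 0]. *)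
Lemma YinvE n x : gr n x -> Yinv gr x = n%:R^-1 *: x.
Proof.
move=> xn; rewrite /Yinv (@gproj_fsum _ _ _ _ _ _ n.+1) => [|m nm]; last first.
  by rewrite (gproj_id _ xn) gtn_eqF.
rewrite big_mkcond big_ord_recr /= (gproj_id _ xn) eqxx big1 ?add0r => [|i _].
  have -> : (n \in [set n | (0 < n)%N]) = (0 < n)%N.
    by apply/idP/idP; rewrite in_setE.
  by case: posnP => // ->; rewrite invr0 scale0r.
by rewrite (gproj_id _ xn) ltn_eqF ?ltn_ord // scaler0 if_same.
Qed.

Lemma natr_neq0 n : [pchar k] =i pred0 -> (0 < n)%N -> n%:R != 0 :> k.
Proof. by move=> /pcharf0P ->; rewrite lt0n. Qed.

End GradedSpace.

(** * Graded connected Hopf algebras *)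

Section GradedHopf.
Variables (k : fieldType) (H : algType k) (hopf : hopf_algebra H) (gr : grading H).
Hypothesis gc : graded_connected hopf gr.
Local Notation Delta := (coprod hopf).
Local Notation eps := (counit hopf : H -> k^o).
Local Notation "f ⋆ g" := (convolution Delta f g) (at level 40, left associativity).
Local Notation Y := (Ygr gr).
Implicit Types f g h : H -> k^o.

Lemma gcomp_scalar a : gr 0 (a%:A : H).
Proof. by rewrite (connected0 gc); exists a. Qed.

Lemma gcomp0P x : gr 0 x -> exists a, x = a%:A.
Proof. by rewrite (connected0 gc) => -[a _ <-]; exists a. Qed.

(** Induction principle for Sweedler sums: by the grading of the coproduct, a
property of [tens_lift b (Delta x)] closed under sums has to be tested only
on [b u v] with [u] and [v] homogeneous of total degree [deg x]. *)
Lemma coprod_closed (W : lmodType k) (b : H -> H -> W) (P : set W) n x :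
  is_bilinear b -> P 0 -> (forall s t, P s -> P t -> P (s + t)) ->
  (forall p u v, (p <= n)%N -> gr p u -> gr (n - p)%N v -> P (b u v)) ->
  gr n x -> P (tens_lift b (Delta x)).
Proof.
move=> bb P0 PD Pb xn; have [t tP ->] := graded_coprod gc xn.
have [L LE] := linear_packed (tens_lift_linear bb).
rewrite LE linear_sum; apply: (big_ind P) => // -[p /= pn] _.
have [s sP ->] := tP p pn.
rewrite linear_sum big_seq; apply: (big_ind P) => // -[u v] /sP[/= up vp].
by rewrite -LE tens_liftE //; apply: (Pb p).
Qed.

Lemma coprod_ext (W : lmodType k) (b b' : H -> H -> W) n x :
  is_bilinear b -> is_bilinear b' ->
  (forall p u v, (p <= n)%N -> gr p u -> gr (n - p)%N v -> b u v = b' u v) ->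
  gr n x -> tens_lift b (Delta x) = tens_lift b' (Delta x).
Proof.
move=> bb bb' bE xn; apply/eqP; rewrite -subr_eq0; apply/eqP.
rewrite -[LHS](sumrB _ _ _ _).
apply: (@coprod_closed _ (fun u v => b u v - b' u v) [set 0] n) => //=.
- split=> [v|u]; apply: linear_sub; [exact: bb.1|exact: bb'.1|exact: bb.2|exact: bb'.2].
- by move=> s t -> ->; rewrite addr0.
- by move=> p u v pn up vp; rewrite (bE p) ?subrr.
Qed.

Lemma convolution_graded (f g : H -> H) n x : linear f -> linear g ->
  (forall p u, gr p u -> gr p (f u)) -> (forall p u, gr p u -> gr p (g u)) ->
  gr n x -> gr n ((f ⋆ g) x).
Proof.
move=> lf lg fgr ggr; rewrite convolutionE //; apply: coprod_closed.
- exact: bilinear_mul.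
- exact: gcomp0.
- exact: gcompD.
by move=> p u v pn /fgr up /ggr vp; have := graded_mul gc up vp; rewrite subnKC.
Qed.

(** The antipode identity exhibits [eps(x) 1], which lies in [H_0], as an
element of [H_n], since [S ⋆ id] preserves the degree. *)
Lemma counit_gcomp n x : (0 < n)%N -> gr n x -> counit hopf x = 0.
Proof.
move=> n0 xn; have : gr n ((counit hopf x)%:A).
  rewrite -(antipodel hopf); apply: convolution_graded => //; first exact: linearP.
  exact: (graded_antipode gc).
move=> /(gcomp_disjoint (gcomp_scalar _)); rewrite eq_sym -lt0n n0 => /(_ isT).
move=> /(congr1 (counit hopf)); rewrite linearZ /= rmorph1 linear0.
by move=> <-; rewrite -[LHS]mulr1.
Qed.

Lemma counitY x : counit hopf (Y x) = 0.
Proof.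
apply: (@graded_ext _ _ gr k^o (eps \o Y) (fun=> 0)) => //.
- exact: (linear_comp (counit_linear _) (Ygr_linear gr)).
- by move=> a u v; rewrite scaler0 addr0.
move=> [|n] u un /=; rewrite (YgrE un); first by rewrite scale0r linear0.
by rewrite linearZ /= (counit_gcomp _ un) ?scaler0.
Qed.

Lemma Y_derivation x y : Y (x * y) = Y x * y + x * Y y.
Proof.
have lY := Ygr_linear gr.
move: x; apply: (graded_ext (gr := gr)).
- exact: (linear_comp lY (linear_mulr y)).
- exact: linear_add (linear_comp (linear_mulr y) lY) (linear_mulr (Y y)).
move=> p x xp; move: y; apply: (graded_ext (gr := gr)).
- exact: (linear_comp lY (linear_mull x)).
- exact: linear_add (linear_mull (Y x)) (linear_comp (linear_mull x) lY).
move=> q y yq; rewrite (YgrE (graded_mul gc xp yq)) (YgrE xp) (YgrE yq).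
by rewrite -scalerAl -scalerAr -scalerDl natrD.
Qed.

Lemma Y_graded n x : gr n x -> gr n (Y x).
Proof. by move=> xn; rewrite (YgrE xn); apply: gcompZ. Qed.

Lemma dynkin_linear : linear (dynkin hopf gr).
Proof. by apply: convolution_linear; [exact: linearP|exact: Ygr_linear]. Qed.

Lemma dynkin_graded n x : gr n x -> gr n (dynkin hopf gr x).
Proof.
apply: convolution_graded; [exact: linearP|exact: Ygr_linear| |exact: Y_graded].
exact: (graded_antipode gc).
Qed.

(** The Dynkin operator preserves the degree, and [Yinv] is a scalar on each
homogeneous component. *)
Lemma Yinv_dynkin x : Yinv gr (dynkin hopf gr x) = dynkin hopf gr (Yinv gr x).
Proof.
have lD := dynkin_linear; have lI := Yinv_linear gr.
apply: (graded_ext (gr := gr) (f := Yinv gr \o dynkin hopf gr)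
  (g := dynkin hopf gr \o Yinv gr)) => //; try exact: linear_comp.
move=> n u un /=; rewrite (YinvE un) (YinvE (dynkin_graded un)).
by rewrite (linear_scaled _ _ lD).
Qed.

(** In degree [n], every term of [f ⋆ g] has its left factor in degree less
than [n], where [f] vanishes, or its right factor in [H_0], where [g]
vanishes.  The inductions on the degree for equation (E) rest on this. *)
Lemma convolution_vanish f g n x : linear f -> linear g -> g 1 = 0 ->
  (forall m u, (m < n)%N -> gr m u -> f u = 0) -> gr n x -> (f ⋆ g) x = 0.
Proof.
move=> lf lg g1 f0 xn; rewrite convolutionE //.
apply: (@coprod_closed _ _ [set 0]) xn => //=; first exact: bilinear_mul.
  by move=> s t -> ->; rewrite addr0.
move=> p u v; rewrite leq_eqVlt => /predU1P[->|pn] up; last first.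
  by rewrite (f0 _ _ pn up) mul0r.
rewrite subnn => /gcomp0P[a ->]; rewrite (linear_scaled _ _ lg).
by rewrite g1 scaler0 mulr0.
Qed.

Hypothesis char0 : [pchar k] =i pred0.

(** The difference of two solutions vanishes on [H_0]; if it vanishes below
degree [n], then [n] times it vanishes in degree [n]. *)
Lemma Y_equation_unique f f' g : linear f -> linear f' -> linear g -> g 1 = 0 ->
  f 1 = f' 1 -> f \o Y =1 f ⋆ g -> f' \o Y =1 f' ⋆ g -> f =1 f'.
Proof.
move=> lf lf' lg g1 ff' fY fY'.
suff e0 n x : gr n x -> f x - f' x = 0.
  by apply: (graded_ext (gr := gr)) => // n x /e0 /subr0_eq.
have le := linear_sub lf lf'.
elim/ltn_ind: n x => -[|n] IHn x xn.
  have [a ->] := gcomp0P xn.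
  by rewrite (linear_scaled _ _ lf) (linear_scaled _ _ lf') ff' subrr.
have /eqP : n.+1%:R *: (f x - f' x) = 0.
  rewrite -(linear_scaled _ _ le) -(YgrE xn).
  have := fY x; have := fY' x => /= -> ->.
  rewrite !convolutionE // -[LHS](sumrB _ _ _ _).
  rewrite -[RHS](@convolution_vanish (fun x => f x - f' x) g n.+1 x) //.
    by rewrite convolutionE //; apply: eq_bigr => p _; rewrite mulrBl.
  by move=> m u /IHn; apply.
by rewrite scaler_eq0 (negPf (natr_neq0 _ _)) // => /eqP.
Qed.

End GradedHopf.

(** * Characters and infinitesimal characters under convolution *)

Section Characters.
Variables (k : fieldType) (H : algType k) (hopf : hopf_algebra H).
Local Notation Delta := (coprod hopf).
Local Notation S := (antipode hopf).
Local Notation eps := (counit hopf : H -> k^o).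
Local Notation "f ⋆ g" := (convolution Delta f g) (at level 40, left associativity).
Implicit Types f g h alpha beta gamma : H -> k^o.

Lemma character_convolution beta (F G : H -> H) :
  characters H beta -> linear F -> linear G ->
  beta \o (F ⋆ G) =1 (beta \o F) ⋆ (beta \o G).
Proof.
move=> [lb _ bM] lF lG x.
have bF := linear_comp lb lF; have bG := linear_comp lb lG.
rewrite /= !convolutionE //; have [B BE] := linear_packed lb.
rewrite BE /tens_lift /tens_eval linear_sum -BE.
by apply: eq_bigr => p _; rewrite bM.
Qed.

Lemma antipode_linear : linear S.
Proof. exact: linearP. Qed.

Lemma character_antipode beta x : characters H beta ->
  beta ((counit hopf x)%:A) = counit hopf x.
Proof. by move=> [lb b1 _]; rewrite (linear_scaled _ _ lb) b1 -[RHS]mulr1. Qed.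

Lemma character_antipodel beta : characters H beta ->
  (beta \o S) ⋆ beta =1 eps.
Proof.
move=> bc x; rewrite -(character_antipode x bc) -(antipodel hopf).
exact/esym/(character_convolution bc antipode_linear (fun _ _ _ => erefl)).
Qed.

Lemma character_antipoder beta : characters H beta ->
  beta ⋆ (beta \o S) =1 eps.
Proof.
move=> bc x; rewrite -(character_antipode x bc) -(antipoder hopf).
exact/esym/(character_convolution bc (fun _ _ _ => erefl) antipode_linear).
Qed.

Lemma character_dynkin (gr : grading H) beta : characters H beta ->
  beta \o dynkin hopf gr =1 (beta \o S) ⋆ (beta \o Ygr gr).
Proof.
by move=> bc; apply: character_convolution => //; [exact: linearP|exact: Ygr_linear].
Qed.

Lemma convolution_eq f f' g g' : f =1 f' -> g =1 g' -> f ⋆ g =1 f' ⋆ g'.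
Proof. by move=> /funext -> /funext ->. Qed.

Lemma character_antipodeK beta f : characters H beta -> linear f ->
  beta ⋆ ((beta \o S) ⋆ f) =1 f.
Proof.
move=> bc lf y; have [lb _ _] := bc.
have lbS := linear_comp lb antipode_linear.
rewrite -convolutionA // -[RHS](convolution_counitl hopf lf).
exact/convolution_eq/frefl/character_antipoder.
Qed.

Lemma antipode_characterK beta f : characters H beta -> linear f ->
  (beta \o S) ⋆ (beta ⋆ f) =1 f.
Proof.
move=> bc lf y; have [lb _ _] := bc.
have lbS := linear_comp lb antipode_linear.
rewrite -convolutionA // -[RHS](convolution_counitl hopf lf).
exact/convolution_eq/frefl/character_antipodel.
Qed.

Lemma convolution_cancel beta f g : characters H beta -> linear f -> linear g ->
  beta ⋆ f =1 beta ⋆ g -> f =1 g.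
Proof.
move=> bc lf lg fg x; have [lb _ _] := bc.
have lbS := linear_comp lb antipode_linear.
suff K h : linear h -> (beta \o S) ⋆ (beta ⋆ h) =1 h.
  by rewrite -(K f) // -(K g) //; apply: convolution_eq.
exact: antipode_characterK.
Qed.

Lemma convolution_addr f g h :
  f ⋆ (fun x => g x + h x) =1 (fun x => (f ⋆ g) x + (f ⋆ h) x).
Proof.
move=> x; rewrite !convolutionE -[RHS]big_split /=.
by apply: eq_bigr => p _; rewrite mulrDr.
Qed.

Lemma convolution_scaler f g a :
  f ⋆ (fun x => a *: g x) =1 (fun x => a *: (f ⋆ g) x).
Proof.
move=> x; rewrite !convolutionE /tens_lift /tens_eval scaler_sumr.
by apply: eq_bigr => p _; rewrite scalerAr.
Qed.

Lemma inf_character1 alpha : inf_characters hopf alpha -> alpha 1 = 0.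
Proof.
move=> [_ aM]; have := aM 1 1; rewrite mulr1 !rmorph1 mulr1 mul1r => /eqP.
by rewrite -subr_eq subrr => /eqP.
Qed.

(** An infinitesimal character turns the coproduct of [x * y] into two sums, in
which one of the two variables is left untouched by the counit axiom. *)
Lemma convolution_inf_mul f g x y : linear f -> inf_characters hopf g ->
  (f ⋆ g) (x * y) = ((fun u => f (u * y)) ⋆ g) x + ((fun v => f (x * v)) ⋆ g) y.
Proof.
move=> lf [lg gM]; rewrite convolution_mul //.
have lfl z : linear (fun u => f (u * z)) by exact: (linear_comp lf (linear_mulr z)).
have lfr z : linear (fun v => f (z * v)) by exact: (linear_comp lf (linear_mull z)).
pose F u := ((fun v => f (u * v)) ⋆ g) y.
have lF : linear F.
  move=> a u v; rewrite /F !convolutionE // -tens_lift_linear_fun.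
  by apply: eq_bigr => p _; rewrite lfl mulrDl scalerAl.
rewrite -[((fun v => f (x * v)) ⋆ g) y]/(F x) -(convolution_counitr hopf lF).
rewrite !convolutionE -[RHS]big_split /=; apply: eq_bigr => p _.
rewrite -[f (p.1 * y)](convolution_counitr hopf (lfr p.1)) /F !convolutionE //.
rewrite /tens_lift /tens_eval !mulr_suml -big_split; apply: eq_bigr => q _ /=.
by rewrite gM mulrDr -!mulrA ![g p.2 * _]mulrC ![counit hopf p.2 * _]mulrC.
Qed.

Lemma convolution_mul_character beta f x y : characters H beta -> linear f ->
  (beta ⋆ f) (x * y) = (beta ⋆ (fun u => (beta ⋆ (fun v => f (u * v))) y)) x.
Proof.
move=> [lb _ bM] lf; rewrite convolution_mul //.
have lfl z : linear (fun u => f (u * z)) by exact: (linear_comp lf (linear_mulr z)).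
have lfr z : linear (fun v => f (z * v)) by exact: (linear_comp lf (linear_mull z)).
rewrite convolutionE //.
apply: eq_bigr => p _; rewrite convolutionE // /tens_lift /tens_eval mulr_sumr.
by apply: eq_bigr => q _; rewrite bM mulrA.
Qed.

(** If [beta o d = beta ⋆ gamma] for a derivation [d], then [gamma] plays the
role of the logarithmic derivative of [beta].  Applying both sides to [x * y]
gives the infinitesimal identity for [gamma] convolved with [beta] in each of
the two variables; [beta] being invertible, it can be cancelled in one
variable and then in the other. *)
Lemma log_derivative_inf beta gamma (d : H -> H) : characters H beta ->
  linear gamma -> linear d -> (forall x y, d (x * y) = d x * y + x * d y) ->
  beta \o d =1 beta ⋆ gamma -> inf_characters hopf gamma.
Proof.
move=> bc lg ld dM dE; split=> // x y; have [lb _ bM] := bc.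
have le := counit_linear hopf.
have lgl z : linear (fun u => gamma (u * z)) by exact: (linear_comp lg (linear_mulr z)).
have lgr z : linear (fun v => gamma (z * v)) by exact: (linear_comp lg (linear_mull z)).
have lM (a b : k) (f g : H -> k^o) : linear f -> linear g ->
    linear (fun u => a *: f u + b *: g u).
  by move=> lf lg'; apply: linear_add; apply: linear_scale.
(* The identity with beta still convolved in the second variable. *)
have E1 u w : (beta ⋆ (fun v => gamma (u * v))) w =
    beta w *: gamma u + (beta ⋆ gamma) w *: counit hopf u.
  move: u; apply: (@convolution_cancel beta) => //.
  - move=> a u v; rewrite !convolutionE // -tens_lift_linear_fun.
    by apply: eq_bigr => p _; rewrite lgl mulrDr scalerAr.
  - exact: (@lM (beta w) ((beta ⋆ gamma) w) gamma eps).
  move=> v; rewrite -convolution_mul_character //.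
  rewrite convolution_addr.
  rewrite !convolution_scaler // convolution_counitr //.
  have := dE (v * w); have := dE v; have := dE w => /= <- <- <-.
  have [B BE] := linear_packed lb.
  by rewrite dM BE linearD -BE !bM [beta w *: _]mulrC [_ *: beta v]mulrC.
rewrite [RHS]addrC.
have -> : gamma x * counit hopf y = gamma x *: (counit hopf y : k^o) by [].
move: y; apply: (@convolution_cancel beta) => //.
  exact: (@lM (counit hopf x) (gamma x) gamma eps).
move=> w; rewrite E1 convolution_addr //; try exact: linear_scale.
rewrite !convolution_scaler // convolution_counitr //.
by rewrite addrC [_ *: counit hopf x]mulrC [beta w *: _]mulrC.
Qed.

End Characters.

(** * Compositions and the coefficients kappa *)

Section Compositions.

(** The last part is split off because the recursion for [kappa] removes the
last letter of a word. *)
Fixpoint compositions (n l : nat) : seq (seq nat) :=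
  if l is l'.+1 then
    [seq rcons w j | j <- iota 1 n, w <- compositions (n - j) l']
  else if n == 0%N then [:: [::]] else [::].

Lemma mem_compositions n l w :
  (w \in compositions n l) =
  [&& size w == l, all (fun j => 0 < j)%N w & sumn w == n].
Proof.
elim: l n w => [|l IHl] n w /=; first by case: w => [|j w]; case: n.
apply/allpairsPdep/idP => [[j [v [jn vn ->]]]|].
  move: jn vn; rewrite mem_iota add1n ltnS IHl => /andP[j0 jn] /and3P[/eqP<- pv /eqP sv].
  by rewrite size_rcons eqxx all_rcons j0 pv sumn_rcons sv subnK ?eqxx.
case/lastP: w => [//|v j]; rewrite size_rcons eqSS all_rcons sumn_rcons.
move=> /and3P[sv /andP[j0 pv] /eqP svn]; exists j, v; split=> //.
  by rewrite mem_iota j0 add1n ltnS -svn leq_addl.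
by rewrite IHl sv pv -svn addnK eqxx.
Qed.

Lemma compositions_uniq n l : uniq (compositions n l).
Proof.
elim: l n => [|l IHl] n /=; first by case: n.
apply: allpairs_uniq_dep => [|j _|]; [exact: iota_uniq|exact: IHl|].
by move=> [j v] [j' v'] _ _ /= /rcons_inj[-> ->].
Qed.

Lemma compositions_small n l : (n < l)%N -> compositions n l = [::].
Proof.
move=> nl; case E : compositions => [//|w s]; have : w \in compositions n l.
  by rewrite E mem_head.
rewrite mem_compositions => /and3P[/eqP sl pw /eqP sn]; move: nl; rewrite -sl -sn ltnNge.
suff -> : (size w <= sumn w)%N by [].
by elim: (w) pw => //= j v IHv /andP[j0 /IHv vs]; rewrite -add1n leq_add.
Qed.

(** The words over which [Qnl] sums are bounded tuples whose alphabet depends on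
[n]; they are replaced by the recursive list of compositions. *)
Lemma tuple_compositions n l :
  perm_eq [seq map val (tval w) | w : l.-tuple 'I_n.+1 <- enum {: l.-tuple 'I_n.+1} &
             all (fun j : 'I_n.+1 => (0 < j)%N) w && (sumn (map val w) == n)]
    (compositions n l).
Proof.
apply: uniq_perm; last 1 first.
- move=> w; rewrite mem_compositions; apply/mapP/idP => [[t]|].
    rewrite mem_filter => /andP[/andP[pt st] _] ->.
    by rewrite size_map size_tuple eqxx all_map st andbT.
  move=> /and3P[/eqP sl pw /eqP sn].
  have bw j : j \in w -> (j < n.+1)%N.
    rewrite ltnS -sn; elim: (w) => //= i v IHv; rewrite inE => /predU1P[->|/IHv].
      exact: leq_addr.
    by move=> /leq_trans; apply; apply: leq_addl.
  have wE : map val (map (fun j => inord j : 'I_n.+1) w) = w.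
    by rewrite -map_comp map_id_in // => j /bw jn; rewrite /= inordK.
  have st : size (map (fun j => inord j : 'I_n.+1) w) == l by rewrite size_map sl.
  exists (Tuple st) => //=; rewrite mem_filter mem_enum inE andbT /= wE sn eqxx andbT.
  by move: pw; rewrite -{1}wE all_map.
- rewrite map_inj_uniq; first exact/filter_uniq/enum_uniq.
  by move=> s t /(inj_map val_inj)/val_inj.
- exact: compositions_uniq.
Qed.

End Compositions.

Section Kappa.
Variable k : fieldType.
Hypothesis char0 : [pchar k] =i pred0.

Lemma kappa_nil : kappa k [::] = 1.
Proof. by rewrite /kappa !big_nil divr1. Qed.

(** The last partial sum in the denominator is the weight of the whole word; all
other partial sums are those of the shorter word. *)
Lemma kappa_rcons w j : (0 < sumn w + j)%N ->
  (sumn w + j)%:R * kappa k (rcons w j) = j%:R * kappa k w.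
Proof.
move=> wj; rewrite /kappa size_rcons [in LHS](@big_cat_nat _ _ _ (size w).+1) //=.
have -> : (\prod_(1 <= i < (size w).+1) sumn (take i (rcons w j)) =
  \prod_(1 <= i < (size w).+1) sumn (take i w))%N.
  apply: eq_big_nat => i /andP[_]; rewrite ltnS => iw.
  by rewrite -cats1 takel_cat.
rewrite big_nat1 take_oversize ?size_rcons // sumn_rcons -cats1 big_cat big_seq1.
have wj0 : (sumn w + j)%:R != 0 :> k by rewrite ((pcharf0P k).1 char0) -lt0n.
by rewrite /= !natrM invfM mulrCA [X in _ * X]mulrCA divff // mulr1 -mulrA mulrCA.
Qed.

End Kappa.

(** * The differential equation satisfied by Q *)

Section Q.
Variables (k : fieldType) (H : algType k) (hopf : hopf_algebra H) (gr : grading H).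
Hypothesis gc : graded_connected hopf gr.
Hypothesis char0 : [pchar k] =i pred0.
Local Notation Delta := (coprod hopf).
Local Notation eps := (counit hopf : H -> k^o).
Local Notation "f ⋆ g" := (convolution Delta f g) (at level 40, left associativity).
Local Notation Y := (Ygr gr).
Implicit Types f g h : H -> k^o.
Variable alpha : H -> k^o.
Hypothesis alpha_lin : linear alpha.
Local Notation word := (word_eval hopf gr alpha).
Local Notation Qn := (Qn hopf gr alpha).
Local Notation Q := (Qmap hopf gr alpha).

Lemma gres_linear j : linear (gres gr alpha j).
Proof. exact: (linear_comp alpha_lin (gproj_linear gr j)). Qed.

Lemma gres_gcomp j n x : gr n x -> gres gr alpha j x = if j == n then alpha x else 0.
Proof.
move=> xn; rewrite /gres /= (gproj_id _ xn); case: eqP => // _.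
by rewrite -(scale0r (0 : H)) (linear_scaled _ _ alpha_lin) scale0r.
Qed.

Lemma word_eval_linear w : linear (word w).
Proof.
elim: w => [|j w IHw] /=; first exact: counit_linear.
by apply: convolution_linear => //; apply: gres_linear.
Qed.

(** Words are evaluated by stripping their first letter; associativity allows
the last one to be stripped instead. *)
Lemma word_eval_rcons w j : word (rcons w j) =1 word w ⋆ gres gr alpha j.
Proof.
have lj := gres_linear.
elim: w => [|i w IHw] x /=.
  by rewrite convolution_counitl ?convolution_counitr.
rewrite convolutionA //; last exact: word_eval_linear.
exact: convolution_eq.
Qed.

Lemma convolution_homogeneous f g a b n x : linear f -> linear g ->
  (forall m u, gr m u -> m != a -> f u = 0) ->
  (forall m u, gr m u -> m != b -> g u = 0) ->
  gr n x -> n != (a + b)%N -> (f ⋆ g) x = 0.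
Proof.
move=> lf lg fa gb xn nab; rewrite convolutionE.
apply: (@coprod_closed _ _ hopf gr gc _ _ [set 0] n x) => //=.
- exact: bilinear_mul.
- by move=> s t -> ->; rewrite addr0.
move=> p u v pn up vp; have [pa|pa] := eqVneq p a; last by rewrite (fa _ _ up pa) mul0r.
rewrite (gb _ _ vp) ?mulr0 //; apply: contraNneq nab => <-.
by rewrite -pa subnKC.
Qed.

Lemma word_eval_homogeneous w n x : gr n x -> n != sumn w -> word w x = 0.
Proof.
elim: w n x => [|j w IHw] n x xn /= nw.
  by apply: (counit_gcomp gc _ xn); rewrite lt0n.
apply: (convolution_homogeneous _ _ _ _ xn nw).
- exact: gres_linear.
- exact: word_eval_linear.
- by move=> m u um mj; rewrite (gres_gcomp _ um) eq_sym (negPf mj).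
- exact: IHw.
Qed.

Definition compositions_sum n l x : k^o :=
  \sum_(w <- compositions n l) kappa k w *: word w x.

Lemma Qnl_compositions n l x : Qnl hopf gr alpha n l x = compositions_sum n l x.
Proof.
rewrite /compositions_sum -(perm_big _ (tuple_compositions n l)) /= big_map big_filter.
by rewrite big_enum_cond; apply: eq_bigl => w; rewrite inE.
Qed.

(** Compositions of [n] have length at most [n], and length 0 only for [n = 0],
so any larger range of lengths may be used, uniformly in [n]. *)
Lemma Qn_compositions n N x : (n < N)%N -> Qn n x = \sum_(l < N) compositions_sum n l x.
Proof.
move=> nN; rewrite /Defs.Qn -(big_mkord xpredT (fun l => compositions_sum n l x)).
rewrite [in RHS](@big_cat_nat _ _ _ n.+1) //= [X in _ + X]big1_seq ?addr0; last first.
  move=> l /=; rewrite mem_index_iota => /andP[nl _].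
  by rewrite /compositions_sum compositions_small // big_nil.
rewrite [in RHS]big_ltn //; case: eqP => [->|/eqP n0].
  by rewrite big_geq // addr0 /compositions_sum big_seq1 kappa_nil scale1r.
rewrite {1}/compositions_sum /= (negPf n0) big_nil add0r.
by apply: eq_bigr => l _; rewrite Qnl_compositions.
Qed.

Lemma Qn_linear n : linear (Qn n).
Proof.
move=> a x y; rewrite !(Qn_compositions _ (ltnSn n)).
have L : linear (fun x => \sum_(l < n.+1) compositions_sum n l x : k^o).
  apply: linear_sum_fun => l; apply: linear_sum_fun => w.
  exact/linear_scale/word_eval_linear.
exact: L.
Qed.

Lemma Qn_homogeneous n m x : gr m x -> m != n -> Qn n x = 0.
Proof.
move=> xm mn; rewrite (Qn_compositions _ (ltnSn n)) big1 // => l _.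
rewrite /compositions_sum big1_seq // => w /=.
rewrite mem_compositions => /and3P[_ _ /eqP sw].
by rewrite (word_eval_homogeneous xm) ?scaler0 ?sw.
Qed.

Lemma compositions_sum_rec n l x : n%:R *: compositions_sum n l.+1 x =
  \sum_(1 <= j < n.+1) j%:R *: (compositions_sum (n - j) l ⋆ gres gr alpha j) x.
Proof.
rewrite {1}/compositions_sum /= big_allpairs_dep /= scaler_sumr.
rewrite /index_iota subn1 /=; apply: eq_big_seq => j.
rewrite mem_iota add1n ltnS => /andP[j0 jn].
rewrite convolutionE /tens_lift /tens_eval /compositions_sum.
under [in RHS]eq_bigr do rewrite mulr_suml.
rewrite exchange_big /= !scaler_sumr; apply: eq_big_seq => w.
rewrite mem_compositions => /and3P[_ _ /eqP sw].
rewrite scalerA -{1}(subnK jn) -sw kappa_rcons ?sw ?subnK ?(leq_trans j0) //.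
rewrite -scalerA word_eval_rcons convolutionE /tens_lift /tens_eval.
by rewrite scaler_sumr; congr (_ *: _); apply: eq_bigr => p _; rewrite scalerAl.
Qed.

Lemma Qn_rec n x : n%:R *: Qn n x =
  \sum_(1 <= j < n.+1) j%:R *: (Qn (n - j) ⋆ gres gr alpha j) x.
Proof.
case: n => [|n]; first by rewrite big_geq // scale0r.
rewrite (Qn_compositions _ (ltnSn n.+1)) big_ord_recl.
rewrite {1}/compositions_sum /= big_nil add0r.
rewrite scaler_sumr; under [LHS]eq_bigr => l _ do rewrite compositions_sum_rec.
rewrite exchange_big; apply: eq_big_nat => j /andP[j0 jn].
rewrite -scaler_sumr; congr (_ *: _).
rewrite convolutionE /tens_lift /tens_eval; under eq_bigr do rewrite convolutionE.
rewrite exchange_big; apply: eq_bigr => p _ /=.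
rewrite -mulr_suml (@Qn_compositions _ n.+1) //.
by rewrite ltn_subLR // -addn1 addnC leq_add2r.
Qed.

Lemma Qmap_sum N x : (forall n, (N <= n)%N -> gproj gr n x = 0) ->
  Q x = \sum_(n < N) Qn n x.
Proof.
move=> pN; rewrite /Qmap -{1}[[set: nat]]set_mem_set.
rewrite -(@bigfs _ _ _ _ (index_iota 0 N)).
- by rewrite big_mkord; apply: eq_bigl => i; exact: in_setT.
- exact: iota_uniq.
move=> n _; rewrite mem_index_iota /= -leqNgt => Nn.
have [F FE] := linear_packed (Qn_linear n).
rewrite (gproj_sum pN) FE linear_sum -FE big1 // => i _.
by rewrite (Qn_homogeneous (gproj_in _ _ _)) // ltn_eqF // (leq_trans _ Nn).
Qed.

Lemma Qmap_gcomp n x : gr n x -> Q x = Qn n x.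
Proof.
move=> xn; rewrite (@Qmap_sum n.+1) => [|m nm]; last first.
  by rewrite (gproj_id _ xn) gtn_eqF.
rewrite big_ord_recr /= big1 ?add0r // => i _.
by rewrite (Qn_homogeneous xn) // gtn_eqF.
Qed.

Lemma Qmap_linear : linear Q.
Proof.
move=> a x y; have [N pN] := gproj_bound gr x; have [M pM] := gproj_bound gr y.
have xN n : (N + M <= n)%N -> gproj gr n x = 0.
  by move=> /(leq_trans (leq_addr _ _))/pN.
have yN n : (N + M <= n)%N -> gproj gr n y = 0.
  by move=> /(leq_trans (leq_addl _ _))/pM.
have xyN n : (N + M <= n)%N -> gproj gr n (a *: x + y) = 0.
  by move=> nNM; rewrite linearP /= xN ?yN ?scaler0 ?addr0.
rewrite !(Qmap_sum xN, Qmap_sum yN, Qmap_sum xyN).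
exact: (linear_sum_fun _ (fun i : 'I__ => Qn_linear i)).
Qed.

Lemma Qmap1 : Q 1 = 1.
Proof.
rewrite (@Qmap_gcomp 0) /Defs.Qn /= ?rmorph1 //.
by rewrite -[1]scale1r; apply: (gcomp_scalar gc).
Qed.

(** In degree [n], the operator [Y] on the left is multiplication by [n] and
[Qn_rec] applies.  On a tensor of bidegree [(p, n - p)] only the letter
[j = n - p] contributes, and [j alpha_j] is [alpha o Y] there. *)
Lemma Qmap_equation : Q \o Y =1 Q ⋆ (alpha \o Y).
Proof.
have lQ := Qmap_linear; have lY := Ygr_linear gr; have laY := linear_comp alpha_lin lY.
apply: (graded_ext (gr := gr)); [exact: linear_comp|exact: convolution_linear|].
move=> n x xn /=; rewrite (YgrE xn) (linear_scaled _ _ lQ) (Qmap_gcomp xn) Qn_rec.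
have lQj j : linear (Qn (n - j)) by exact: Qn_linear.
rewrite convolutionE; under eq_bigr do rewrite convolutionE.
transitivity (tens_lift (fun u v =>
    \sum_(1 <= j < n.+1) j%:R *: (Qn (n - j) u * gres gr alpha j v)) (Delta x)).
  rewrite /tens_lift /tens_eval [RHS]exchange_big; apply: eq_bigr => j _.
  by rewrite scaler_sumr.
apply: (coprod_ext gc) xn; last 1 first.
- move=> p u v pn up vp; rewrite (Qmap_gcomp up) /=.
  rewrite (YgrE vp) (linear_scaled _ _ alpha_lin).
  have [pE|np] := eqVneq p n.
    rewrite {}pE in up *; rewrite subnn scale0r mulr0 big_nat big1 // => j /andP[j0 jn].
    rewrite (Qn_homogeneous up) ?mul0r ?scaler0 //.
    by rewrite gtn_eqF // ltn_subrL j0 (leq_trans j0).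
  rewrite (bigD1_seq (n - p)%N) /=; last 2 first.
  + by rewrite mem_index_iota subn_gt0 ltn_neqAle np pn ltnS leq_subr.
  + exact: iota_uniq.
  rewrite (gres_gcomp _ vp) eqxx subKn // big1 ?addr0 => [|j jp]; last first.
    by rewrite (gres_gcomp _ vp) (negPf jp) mulr0 scaler0.
  by rewrite scalerAr.
- split=> [v|u]; apply: linear_sum_fun => j; apply: linear_scale.
    exact: (linear_comp (linear_mulr _) (lQj j)).
  exact: (linear_comp (linear_mull _) (gres_linear j)).
- exact: bilinear_mul.
Qed.
End Q.

(** * The bijection and its inverse *)

Section Bijection.
Variables (k : fieldType) (H : algType k) (hopf : hopf_algebra H) (gr : grading H).
Hypothesis gc : graded_connected hopf gr.
Hypothesis char0 : [pchar k] =i pred0.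
Local Notation Delta := (coprod hopf).
Local Notation S := (antipode hopf).
Local Notation D := (dynkin hopf gr).
Local Notation eps := (counit hopf : H -> k^o).
Local Notation "f ⋆ g" := (convolution Delta f g) (at level 40, left associativity).
Local Notation Y := (Ygr gr).
Local Notation Q := (Qmap hopf gr).
Implicit Types f g h alpha beta gamma : H -> k^o.

Lemma inf_characterY alpha :
  inf_characters hopf alpha -> inf_characters hopf (alpha \o Y).
Proof.
move=> [la aM]; split=> [|x y /=]; first exact: linear_comp (Ygr_linear gr).
have [A AE] := linear_packed la.
rewrite (Y_derivation gc) AE linearD -AE !aM !(counitY gc).
by rewrite mulr0 mul0r addr0 add0r.
Qed.

(** On homogeneous [x] and [y] of degrees [p] and [q], the factor [1/(p + q)]
can be replaced by [1/p] in front of [gamma x * eps y], which vanishes unless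
[q = 0], and symmetrically. *)
Lemma inf_characterYinv gamma :
  inf_characters hopf gamma -> inf_characters hopf (gamma \o Yinv gr).
Proof.
move=> [lg gM]; have le := counit_linear hopf; have lI := Yinv_linear gr.
have lgI := linear_comp lg lI.
split=> // x y; move: x; apply: (@graded_ext _ _ gr k^o
  (fun x => (gamma \o Yinv gr) (x * y))).
- exact: (linear_comp lgI (linear_mulr y)).
- apply: linear_add; first exact: (linear_comp (@linear_mulr k k^o _) lgI).
  exact: (linear_comp (@linear_mulr k k^o _) le).
move=> p x xp; move: y; apply: (@graded_ext _ _ gr k^o
  (fun y => (gamma \o Yinv gr) (x * y))).
- exact: (linear_comp lgI (linear_mull x)).
- apply: linear_add; first exact: (linear_comp (@linear_mull k k^o _) le).
  exact: (linear_comp (@linear_mull k k^o _) lgI).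
move=> q y yq /=; rewrite (YinvE (graded_mul gc xp yq)) (YinvE xp) (YinvE yq).
rewrite !(linear_scaled _ _ lg) gM scalerDr scalerAl scalerAr.
congr (_ + _).
  case: q yq => [|q] yq; first by rewrite addn0.
  by rewrite (counit_gcomp gc _ yq) // !mulr0.
case: p xp => [|p] xp; first by rewrite add0n.
by rewrite (counit_gcomp gc _ xp) // !mul0r.
Qed.

(** [Yinv] inverts [Y] only in positive degrees, but infinitesimal characters
vanish in degree 0. *)
Lemma inf_character_YinvY alpha : inf_characters hopf alpha ->
  alpha \o Yinv gr \o Y =1 alpha.
Proof.
move=> ai; have [la _] := ai.
apply: (graded_ext (gr := gr)) => //.
  exact: (linear_comp (linear_comp la (Yinv_linear gr)) (Ygr_linear gr)).
move=> [|n] x xn /=.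
  have [a ->] := gcomp0P gc xn.
  have z b : alpha (b%:A) = 0.
    by rewrite (linear_scaled _ _ la) (inf_character1 ai) scaler0.
  rewrite z (YgrE (gcomp_scalar gc a)) (linear_scaled _ _ (Yinv_linear gr)).
  by rewrite (linear_scaled _ _ la) scale0r.
have nz := natr_neq0 char0 (ltn0Sn n).
by rewrite (YinvE (Y_graded xn)) (YgrE xn) scalerA mulVf // scale1r.
Qed.

Lemma inf_character_YYinv alpha : inf_characters hopf alpha ->
  alpha \o Y \o Yinv gr =1 alpha.
Proof.
move=> ai x /=; rewrite -[RHS](inf_character_YinvY ai) /=; congr alpha.
move: x; apply: (graded_ext (gr := gr)).
- exact: (linear_comp (Ygr_linear gr) (Yinv_linear gr)).
- exact: (linear_comp (Yinv_linear gr) (Ygr_linear gr)).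
move=> n x xn; rewrite (YinvE xn) (YgrE xn) (linear_scaled _ _ (Ygr_linear gr)).
by rewrite (linear_scaled _ _ (Yinv_linear gr)) (YinvE xn) (YgrE xn) !scalerA mulrC.
Qed.

(** Induction on the total degree for the multiplicativity defect [E]: the
derivation property of [Y] yields [Erec], whose right-hand side vanishes
by the induction hypothesis. *)
Lemma Y_equation_character f gamma : linear f -> inf_characters hopf gamma ->
  f 1 = 1 -> f \o Y =1 f ⋆ gamma -> characters H f.
Proof.
move=> lf gi f1 fY; split=> //; have [lg _] := gi.
have lfr z : linear (fun v => f (z * v)) by exact: (linear_comp lf (linear_mull z)).
have lfl z : linear (fun v => f (v * z)) by exact: (linear_comp lf (linear_mulr z)).
have lmr (c : k^o) : linear (fun y => c * f y).
  exact: (linear_comp (@linear_mull k k^o _) lf).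
have lml (c : k^o) : linear (fun x => f x * c).
  exact: (linear_comp (@linear_mulr k k^o _) lf).
pose E x y := f (x * y) - f x * f y.
have El y : linear (E^~ y) by exact: linear_sub.
have Er x : linear (E x) by exact: linear_sub.
have Erec x y : E (Y x) y + E x (Y y) = ((E^~ y) ⋆ gamma) x + ((E x) ⋆ gamma) y.
  have -> : ((E^~ y) ⋆ gamma) x =
      ((fun u => f (u * y)) ⋆ gamma) x - (f ⋆ gamma) x * f y.
    rewrite !convolutionE /tens_lift /tens_eval mulr_suml -sumrB; apply: eq_bigr => p _.
    by rewrite mulrBl mulrAC.
  have -> : ((E x) ⋆ gamma) y =
      ((fun v => f (x * v)) ⋆ gamma) y - f x * (f ⋆ gamma) y.
    rewrite !convolutionE /tens_lift /tens_eval mulr_sumr -sumrB; apply: eq_bigr => p _.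
    by rewrite mulrBl mulrA.
  rewrite [RHS]addrACA -convolution_inf_mul // -!fY /= (Y_derivation gc).
  by have [F FE] := linear_packed lf; rewrite FE linearD -FE [RHS]addrACA.
suff E0 n p q x y : (p + q)%N = n -> gr p x -> gr q y -> E x y = 0.
  move=> x y; apply: subr0_eq; rewrite -/(E x y).
  have l0 : linear (fun _ : H => 0 : k^o) by move=> a u v; rewrite scaler0 addr0.
  move: x; apply: (@graded_ext _ _ gr k^o (E^~ y) (fun=> 0)) => // p x xp.
  by move: y; apply: (@graded_ext _ _ gr k^o (E x) (fun=> 0)) => // q y; exact: E0 xp.
elim/ltn_ind: n p q x y => n IHn p q x y pq xp yq.
have [n0|n0] := posnP n.
  move: pq; rewrite n0 => /eqP; rewrite addn_eq0 => /andP[/eqP p0 /eqP q0].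
  rewrite {}p0 {}q0 in xp yq; have [a ->] := gcomp0P gc xp; have [b ->] := gcomp0P gc yq.
  rewrite (linear_scaled _ _ (El _)) (linear_scaled _ _ (Er _)) /E mulr1 f1.
  by rewrite mulr1 subrr !scaler0.
have /eqP : n%:R *: E x y = 0.
  rewrite -pq natrD scalerDl -(linear_scaled _ _ (El y)) -(linear_scaled _ _ (Er x)).
  rewrite -(YgrE xp) -(YgrE yq) Erec.
  rewrite (convolution_vanish gc _ _ _ _ xp) ?add0r ?(inf_character1 gi) //.
    apply: (convolution_vanish gc _ _ _ _ yq); rewrite ?(inf_character1 gi) //.
    move=> m u mq um; apply: (IHn (p + m)%N _ p m) => //.
    by rewrite -pq ltn_add2l.
  move=> m u mp um; apply: (IHn (m + q)%N _ m q) => //.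
  by rewrite -pq ltn_add2r.
by rewrite scaler_eq0 (negPf (natr_neq0 char0 n0)) => /eqP.
Qed.

Lemma Qmap_character alpha : inf_characters hopf alpha -> characters H (Q alpha).
Proof.
move=> ai; have [la _] := ai.
exact: (Y_equation_character (Qmap_linear gc la) (inf_characterY ai)
  (Qmap1 gc la) (Qmap_equation gc char0 la)).
Qed.

(** Multiply [beta o D = (beta o S) ⋆ (beta o Y)] by [beta] on the left. *)
Lemma dynkin_log_derivative beta : characters H beta ->
  beta ⋆ (beta \o D) =1 beta \o Y.
Proof.
move=> bc; have [lb _ _] := bc; have lbY := linear_comp lb (Ygr_linear gr).
move=> x; rewrite -[RHS](character_antipodeK hopf bc lbY).
by apply: convolution_eq => // y; apply: character_dynkin.
Qed.

Lemma inf_character_dynkin beta : characters H beta -> inf_characters hopf (beta \o D).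
Proof.
move=> bc; have [lb _ _] := bc.
apply: (log_derivative_inf bc (linear_comp lb (dynkin_linear hopf gr))
  (Ygr_linear gr) (Y_derivation gc)) => x.
by rewrite (dynkin_log_derivative bc).
Qed.

Lemma Yinv_dynkin_comp beta : beta \o Yinv gr \o D = (beta \o D) \o Yinv gr.
Proof. by apply/funext => x /=; rewrite (Yinv_dynkin gc). Qed.

Lemma Qmap_dynkinK alpha : inf_characters hopf alpha ->
  Q alpha \o Yinv gr \o D = alpha.
Proof.
move=> ai; have [la _] := ai; have qc := Qmap_character ai; have [lq _ _] := qc.
rewrite Yinv_dynkin_comp; apply/funext => x.
rewrite -[RHS](inf_character_YYinv ai) /=; move: (Yinv gr x).
have laY := linear_comp la (Ygr_linear gr).
apply: (convolution_cancel qc (linear_comp lq (dynkin_linear hopf gr)) laY) => y.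
exact: etrans (dynkin_log_derivative qc y) (Qmap_equation gc char0 la y).
Qed.

Lemma dynkin_QmapK beta : characters H beta -> Q (beta \o Yinv gr \o D) = beta.
Proof.
move=> bc; have [lb b1 _] := bc; have gi := inf_character_dynkin bc.
have ai := inf_characterYinv gi; have [la _] := ai; have [lg _] := gi.
rewrite Yinv_dynkin_comp; apply/funext.
apply: (Y_equation_unique gc char0 (Qmap_linear gc la) lb lg (inf_character1 gi)).
- by rewrite (Qmap1 gc la).
- move=> x; rewrite (Qmap_equation gc char0 la); apply: convolution_eq => //.
  exact: inf_character_YinvY.
- by move=> x; rewrite (dynkin_log_derivative bc).
Qed.

End Bijection.

Theorem proposition4p4 (k : fieldType) (H : comAlgType k)
    (hopf : hopf_algebra H) (gr : grading H) :
  [pchar k] =i pred0 ->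
  graded_connected hopf gr ->
  set_bij (inf_characters hopf) (characters H) (Qmap hopf gr) /\
  (forall beta : H -> k^o, characters H beta ->
     inf_characters hopf (beta \o Yinv gr \o dynkin hopf gr) /\
     Qmap hopf gr (beta \o Yinv gr \o dynkin hopf gr) = beta) /\
  (forall alpha : H -> k^o, inf_characters hopf alpha ->
     Qmap hopf gr alpha \o Yinv gr \o dynkin hopf gr = alpha).
Proof.
move=> char0 gc.
have inf_inv (beta : H -> k^o) : characters H beta ->
    inf_characters hopf (beta \o Yinv gr \o dynkin hopf gr).
  move=> bc; rewrite (Yinv_dynkin_comp gc).
  exact/(inf_characterYinv gc)/(inf_character_dynkin gc).
have QK := Qmap_dynkinK gc char0; have KQ := dynkin_QmapK gc char0.
split; last by split=> // beta bc; split; [exact: inf_inv|exact: KQ].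
split.
- by move=> alpha; apply: Qmap_character.
- by move=> alpha alpha' /set_mem/QK {2}<- /set_mem/QK {2}<- ->.
- by move=> beta bc; exists (beta \o Yinv gr \o dynkin hopf gr);
    [exact: inf_inv|exact: KQ].
Qed.
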